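(* The $4$-qubit doilies fall into exactly $95$ distinct types, of which $24$ are types of linear doilies and $71$ are types of quadratic doilies. The $5$-qubit doilies fall into exactly $447$ distinct types, of which $89$ are types of linear doilies and $358$ are types of quadratic doilies. Here the type of an $N$-qubit doily is the pair consisting of its signature and its character (linear or quadratic).
   Context: An $N$-qubit observable is a word of length $N$ over $\{I,X,Y,Z\}$ other than $I\cdots I$, encoding the tensor product of the corresponding identity/Pauli matrices. It is identified with a nonzero vector of $\mathbb{F}_2^{2N}$, letter $j$ corresponding to $(x_j,x_{j+N})$ via $I\leftrightarrow(0,0)$, $X\leftrightarrow(0,1)$, $Y\leftrightarrow(1,1)$, $Z\leftrightarrow(1,0)$; two observables commute if and only if $\sigma(x,y)=\sum_{j=1}^N(x_jy_{N+j}+x_{N+j}y_j)=0$, and products of observables correspond, up to a scalar, to sums of vectors. An $N$-qubit doily is a set of 15 distinct $N$-qubit observables carrying the structure of the generalized quadrangle $\mathrm{GQ}(2,2)$ (15 points, 15 lines, 3 points per line, 3 lines per point, and for a point $p$ not on a line $L$ a unique point of $L$ collinear with $p$), such that two distinct observables of the set commute if and only if they lie on a common line, and on each line the product of two of the observables is, up to sign, the third. It is linear if its 15 vectors span a 4-dimensional subspace of $\mathbb{F}_2^{2N}$ (a $\mathrm{PG}(3,2)$), and quadratic if they span a 5-dimensional subspace (a $\mathrm{PG}(4,2)$). The signature of an $N$-qubit doily is the $N$-tuple $(n_1,\dots,n_N)$ where $n_k$ is the number of its 15 observables that contain exactly $N-k$ letters $I$. *)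

(* Defs.v *)
From HB Require Import structures.
From mathcomp Require Import all_boot all_order all_algebra all_field.
From mathcomp Require Import mxtens.

Set Implicit Arguments.
Unset Strict Implicit.
Unset Printing Implicit Defensive.
Import GRing.Theory Num.Theory.

Local Open Scope ring_scope.

Inductive pauli := PI | PX | PY | PZ.

(* I, X, Y, Z correspond to (0,0), (0,1), (1,1), (1,0). *)
Definition pauli_bits (a : pauli) : 'F_2 * 'F_2 :=
  match a with PI => (0, 0) | PX => (0, 1) | PY => (1, 1) | PZ => (1, 0) end.

Definition pauli_of_bits (u : 'F_2 * 'F_2) : pauli :=
  if u.1 == 0 then (if u.2 == 0 then PI else PX)
  else (if u.2 == 0 then PZ else PY).

Lemma pauli_bitsK : cancel pauli_bits pauli_of_bits.
Proof. by case. Qed.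

HB.instance Definition _ := Countable.copy pauli (can_type pauli_bitsK).
HB.instance Definition _ : isFinite pauli := CanIsFinite pauli_bitsK.

Definition pauli_mx (a : pauli) : 'M[algC]_2 :=
  \matrix_(i, j)
    nth 0 (nth [::] (match a with
                     | PI => [:: [:: 1; 0]; [:: 0; 1]]
                     | PX => [:: [:: 0; 1]; [:: 1; 0]]
                     | PY => [:: [:: 0; - 'i]; [:: 'i; 0]]
                     | PZ => [:: [:: 1; 0]; [:: 0; -1]]
                     end) i) j.

(* 2 ^ N, in the form 2 * (2 * ... (2 * 1)) computed by iterated Kronecker
   products. *)
Definition hilbert_dim (N : nat) : nat := iter N (muln 2) 1%N.

Fixpoint word_mx (N : nat) : N.-tuple pauli -> 'M[algC]_(hilbert_dim N) :=
  match N with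
  | 0 => fun _ => 1%:M
  | N'.+1 => fun w => pauli_mx (thead w) *t word_mx [tuple of behead w]
  end.

Definition word_vec (N : nat) (w : N.-tuple pauli) : 'rV['F_2]_(N + N) :=
  row_mx (\row_j (pauli_bits (tnth w j)).1) (\row_j (pauli_bits (tnth w j)).2).

Definition observable (N : nat) : Type :=
  {w : N.-tuple pauli | w != [tuple of nseq N PI]}.

HB.instance Definition _ (N : nat) := Finite.on (observable N).

Definition obs_mx (N : nat) (a : observable N) := word_mx (val a).
Definition obs_vec (N : nat) (a : observable N) := word_vec (val a).

Section GQ22.
Variable T : finType.
Implicit Types (P : {set T}) (L : {set {set T}}).

Definition collinear L (p q : T) : bool :=
  [exists l in L, (p \in l) && (q \in l)].

(* That two distinct points lie on at most one line follows from the last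
   condition: if two lines met in {a, b}, the third point of one of them would
   be collinear with both a and b on the other. *)
Definition is_GQ22 P L : bool :=
  [&& #|P| == 15%N, #|L| == 15%N,
      [forall l in L, (l \subset P) && (#|l| == 3%N)],
      [forall p in P, #|[set l in L | p \in l]| == 3%N] &
      [forall p in P, forall l in L,
         (p \notin l) ==> (#|[set q in l | collinear L p q]| == 1%N)]].
End GQ22.

Section Doilies.
Variable N : nat.
Implicit Types (D : {set observable N}) (L : {set {set observable N}}).

Definition is_doily_with D L : bool :=
  [&& is_GQ22 D L,
      [forall a in D, forall b in D, (a != b) ==>
         (comm_mxb (obs_mx a) (obs_mx b) == collinear L a b)] &
      [forall l in L, forall a in l, forall b in l, forall c in l,
         uniq [:: a; b; c] ==>
           ((obs_mx a *m obs_mx b == obs_mx c)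
              || (obs_mx a *m obs_mx b == - obs_mx c))]].

Definition is_doily D : bool := [exists L, is_doily_with D L].

Definition span_dim D : nat := \dim <<[seq obs_vec a | a in D]>>%VS.

(* The entry at index k : 'I_N, counted from 0, is n_(k+1). *)
Definition signature D : N.-tuple nat :=
  [tuple #|[set a in D | count_mem PI (val a) == (N - k.+1)%N]| | k < N].
End Doilies.

Inductive doily_character := Linear | Quadratic.

Definition bool_of_character c := if c is Linear then true else false.
Definition character_of_bool b := if b then Linear else Quadratic.
Lemma bool_of_characterK : cancel bool_of_character character_of_bool.
Proof. by case. Qed.
HB.instance Definition _ :=
  Equality.copy doily_character (can_type bool_of_characterK).

(* None is a safeguard: a doily whose span had any other dimension would have
   a type of its own, neither linear nor quadratic. *)
Definition character (N : nat) (D : {set observable N})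
    : option doily_character :=
  if span_dim D == 4%N then Some Linear
  else if span_dim D == 5%N then Some Quadratic
  else None.

Definition doily_type (N : nat) (D : {set observable N})
    : N.-tuple nat * option doily_character :=
  (signature D, character D).

(* The duplicate-free list of the types that occur. *)
Definition doily_types (N : nat) : seq (N.-tuple nat * option doily_character) :=
  undup [seq doily_type D | D : {set observable N} in @is_doily N].

(* Main.v *)
Require Import Defs.
From mathcomp Require Import all_boot all_order all_algebra all_field.
From mathcomp Require Import mxtens ring zify.

(* Five observables p, q, x, y, z of a doily such that p, q anticommute, x, y, z
   anticommute pairwise and p, q commute with x, y, z generate it: its points
   are p, q, x, y, z and the sums of p or q with one of x, y, z, of p + q with
   two of them, and of p + q with all three. Conversely any five words with
   these commutation relations generate a doily, which is linear iff the
   nucleus x + y + z vanishes. Reading the five words letter by letter turns a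
   doily into N columns of five letters. The signature and the character depend
   only on the Gram vector of each column (which pairs of its entries
   anticommute) and on the set of points that have the letter I there, which
   leaves 187 kinds of columns, and the only constraint is that the Gram vectors
   sum to a fixed vector. The 720 choices of (p, q, x, y, z) in a given doily
   reduce the first two columns to 224 pairs, and the remaining columns are
   enumerated by computation. *)

Set Implicit Arguments.
Unset Strict Implicit.
Unset Printing Implicit Defensive.
Import GRing.Theory Num.Theory.

(** * Pauli words *)

Definition padd (a b : pauli) : pauli :=
  match a, b with
  | PI, _ => b
  | _, PI => a
  | PX, PX | PY, PY | PZ, PZ => PI
  | PX, PY | PY, PX => PZ
  | PY, PZ | PZ, PY => PX
  | PX, PZ | PZ, PX => PY
  end.

Definition panti (a b : pauli) : bool :=
  match a, b with
  | PI, _ | _, PI | PX, PX | PY, PY | PZ, PZ => false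
  | _, _ => true
  end.

Fixpoint wanti (u v : seq pauli) : bool :=
  match u, v with
  | a :: u', b :: v' => panti a b (+) wanti u' v'
  | _, _ => false
  end.

Definition wadd N (u v : N.-tuple pauli) : N.-tuple pauli :=
  [tuple of [seq padd x.1 x.2 | x <- zip u v]].

Lemma paddC : commutative padd. Proof. by do 2 case. Qed.
Lemma paddA : associative padd. Proof. by do 3 case. Qed.
Lemma padda a : padd a a = PI. Proof. by case: a. Qed.
Lemma pantiC a b : panti a b = panti b a. Proof. by case: a; case: b. Qed.
Lemma pantia a : panti a a = false. Proof. by case: a. Qed.
Lemma panti_addr a b c : panti a (padd b c) = panti a b (+) panti a c.
Proof. by case: a; case: b; case: c. Qed.
Lemma panti_addl a b c : panti (padd a b) c = panti a c (+) panti b c.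
Proof. by rewrite !(pantiC _ c) panti_addr. Qed.

Lemma wantiC u v : wanti u v = wanti v u.
Proof. by elim: u v => [|a u IHu] [|b v] //=; rewrite pantiC IHu. Qed.

Lemma wanti_nseqI n w : wanti w (nseq n PI) = false.
Proof. by elim: w n => [|a w IHw] [|n] //=; rewrite IHw; case: a. Qed.

(** * Products and commutation of Pauli words as matrices *)

Section Matrices.
Local Open Scope ring_scope.

Definition phase (a b : pauli) : algC :=
  match a, b with
  | PX, PY | PY, PZ | PZ, PX => 'i
  | PY, PX | PZ, PY | PX, PZ => - 'i
  | _, _ => 1
  end.

Fixpoint wphase (u v : seq pauli) : algC :=
  match u, v with
  | a :: u', b :: v' => phase a b * wphase u' v'
  | _, _ => 1
  end.

Lemma pauli_mx_mul a b :
  pauli_mx a *m pauli_mx b = phase a b *: pauli_mx (padd a b).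
Proof.
apply/matrixP=> i j; rewrite !mxE !big_ord_recl big_ord0 !mxE.
have ii : 'i * 'i = -1 :> algC by rewrite -expr2 sqrCi.
case: i j => [[|[|i]] // hi] [[|[|j]] // hj]; case: a; case: b => /=;
  by rewrite ?(mulr0, mul0r, addr0, add0r, mulr1, mul1r, mulrN, mulNr, ii,
               opprK, mulN1r, mulrN1, oppr0).
Qed.

Lemma phase_swap a b : phase b a = (-1) ^+ panti a b * phase a b.
Proof.
by case: a; case: b; rewrite /= ?expr0 ?mul1r // expr1 mulN1r ?opprK.
Qed.

Lemma phase_sqr a b : phase a b ^+ 2 = (-1) ^+ panti a b.
Proof. by case: a; case: b; rewrite /= ?sqrrN ?sqrCi ?expr1n. Qed.

Lemma wphase_swap u v : wphase v u = (-1) ^+ wanti u v * wphase u v.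
Proof.
elim: u v => [|a u IHu] [|b v] /=; rewrite ?mulr1 //.
by rewrite phase_swap IHu signr_addb mulrACA.
Qed.

(** Shows both that the phase never vanishes and that it is a sign when the words commute. *)
Lemma wphase_sqr u v : wphase u v ^+ 2 = (-1) ^+ wanti u v.
Proof.
elim: u v => [|a u IHu] [|b v] /=; rewrite ?expr1n //.
by rewrite exprMn phase_sqr IHu signr_addb.
Qed.

Lemma wphase_neq0 u v : wphase u v != 0.
Proof.
by apply/eqP=> h; have /eqP := wphase_sqr u v; rewrite h expr0n eq_sym signr_eq0.
Qed.

Lemma word_mx_cons N a (w : N.-tuple pauli) :
  word_mx [tuple of a :: w] = pauli_mx a *t word_mx w.
Proof. by rewrite /= theadE; congr (_ *t word_mx _); apply: val_inj. Qed.

Lemma wadd_cons N a b (u v : N.-tuple pauli) :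
  wadd [tuple of a :: u] [tuple of b :: v] = [tuple of padd a b :: wadd u v].
Proof. exact: val_inj. Qed.

Lemma word_mx_mul N (u v : N.-tuple pauli) :
  word_mx u *m word_mx v = wphase u v *: word_mx (wadd u v).
Proof.
elim: N u v => [|N IHN] u v.
  by rewrite (tuple0 u) (tuple0 v) /= mulmx1 scale1r.
case/tupleP: u => a u; case/tupleP: v => b v.
rewrite wadd_cons !word_mx_cons [LHS]tensmx_mul pauli_mx_mul IHN /=.
apply/matrixP=> i j; rewrite !mxE; ring.
Qed.

Lemma word_mx_sqr N (u : N.-tuple pauli) : word_mx u *m word_mx u = 1%:M.
Proof.
elim: N u => [|N IHN] u; first by rewrite (tuple0 u) /= mulmx1.
case/tupleP: u => a u; rewrite word_mx_cons [LHS]tensmx_mul IHN pauli_mx_mul.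
have -> : phase a a *: pauli_mx (padd a a) = 1%:M.
  have -> : phase a a = 1 by case: a.
  rewrite scale1r padda; apply/matrixP=> i j; rewrite !mxE.
  by case: i j => [[|[|i]] // hi] [[|[|j]] // hj].
apply/matrixP=> i j; case: (mxtens_indexP i) => i0 i1.
case: (mxtens_indexP j) => j0 j1; rewrite tensmxE !mxE.
by rewrite (can_eq (@mxtens_indexK _ _)) xpair_eqE -natrM mulnb.
Qed.

Lemma word_mx_neq0 N (u : N.-tuple pauli) : word_mx u != 0.
Proof.
apply/eqP=> h; have := word_mx_sqr u; rewrite h mul0mx => /esym/eqP.
have : (0 < hilbert_dim N)%N by elim: (N) => //= n IHn; rewrite muln_gt0.
by case: (hilbert_dim N) => // n _; rewrite oner_eq0.
Qed.

Lemma waddC N (u v : N.-tuple pauli) : wadd u v = wadd v u.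
Proof.
apply: val_inj => /=; case: u v => u hu [v hv] /=.
have {hu hv} : size u = size v by rewrite (eqP hu) (eqP hv).
by elim: u v => [|a u IHu] [|b v] //= [/IHu ->]; rewrite paddC.
Qed.

(** Swapping the factors multiplies the phase by (-1) to the power [wanti u v]. If this sign is -1,
    commutation would make twice a nonzero matrix vanish. *)
Lemma comm_word_mx N (u v : N.-tuple pauli) :
  comm_mxb (word_mx u) (word_mx v) = ~~ wanti u v.
Proof.
rewrite /comm_mxb !word_mx_mul (waddC v) (wphase_swap u v).
case: (wanti u v); last by rewrite expr0 mul1r eqxx.
rewrite expr1 mulN1r scaleNr -subr_eq0 opprK -mulr2n -scaler_nat scaler_eq0.
by rewrite pnatr_eq0 scaler_eq0 (negPf (wphase_neq0 _ _)) (negPf (word_mx_neq0 _)).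
Qed.

(** Nondegeneracy of the symplectic form: a letter is determined by whether it anticommutes with X
    and with Y, and words with I elsewhere isolate one letter. *)
Lemma wanti_inj N (u v : N.-tuple pauli) :
  (forall w : N.-tuple pauli, wanti u w = wanti v w) -> u = v.
Proof.
elim: N u v => [|N IHN] u v h; first by rewrite (tuple0 u) (tuple0 v).
case/tupleP: u h => a u; case/tupleP: v => b v h.
have eab c : panti a c = panti b c.
  have := h [tuple of c :: nseq N PI] => /=.
  by rewrite !wanti_nseqI !addbF.
have -> : a = b by move: (eab PX) (eab PY); case: (a); case: (b).
congr [tuple of _ :: _]; apply: IHN => w.
by have /= := h [tuple of PI :: w]; case: (a) (b) => [] [].
Qed.

(** The phase of a commuting product is a sign. Conversely, proportional matrices commute with the
    same words, so nondegeneracy of [wanti] identifies [w] without linear independence of the Pauli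
    matrices. *)
Lemma word_mx_prodP N (u v w : N.-tuple pauli) : ~~ wanti u v ->
  (word_mx u *m word_mx v == word_mx w) || (word_mx u *m word_mx v == - word_mx w)
  = (w == wadd u v).
Proof.
move=> uv; rewrite word_mx_mul.
have ph1 : (wphase u v == 1) || (wphase u v == -1).
  by rewrite -eqf_sqr wphase_sqr (negPf uv) expr0 expr1n.
apply/idP/eqP => [h|->]; last first.
  by case/orP: ph1 => /eqP ->; rewrite ?scale1r ?scaleN1r eqxx ?orbT.
have [l l0 e] : exists2 l : algC, l != 0 & word_mx w = l *: word_mx (wadd u v).
  case/orP: h => /eqP h; first by exists (wphase u v); rewrite ?wphase_neq0.
  by exists (- wphase u v); rewrite ?oppr_eq0 ?wphase_neq0 // scaleNr h opprK.
apply: wanti_inj => x; apply: negb_inj; rewrite -!comm_word_mx e /comm_mxb.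
by rewrite -scalemxAl -scalemxAr (inj_eq (scalerI l0)).
Qed.
End Matrices.

(** * Gram vectors of columns *)

(** A column [c] holds the letters of the generators at one position; this is the letter there of
    the sum of generators with coordinates [u]. *)
Fixpoint lin (u : seq bool) (c : seq pauli) : pauli :=
  match u, c with
  | x :: u', a :: c' => if x then padd a (lin u' c') else lin u' c'
  | _, _ => PI
  end.

(** A missing tail counts as zero, so [[::]] is neutral and can start a fold. *)
Fixpoint bxor (u v : seq bool) : seq bool :=
  match u, v with
  | [::], _ => v
  | _, [::] => u
  | x :: u', y :: v' => x (+) y :: bxor u' v'
  end.

Fixpoint dot (u v : seq bool) : bool :=
  match u, v with
  | x :: u', y :: v' => (x && y) (+) dot u' v'
  | _, _ => false
  end.

Fixpoint pairing (T S : Type) (r : T -> T -> S) (s : seq T) : seq S :=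
  if s is x :: s' then map (r x) s' ++ pairing r s' else [::].

Definition gram : seq pauli -> seq bool := pairing panti.

(* The bilinear form whose values on pairs of distinct unit vectors are listed,
   in lexicographic order, by g. *)
Fixpoint bil (g u v : seq bool) : bool :=
  match u, v with
  | x :: u', y :: v' =>
      (x && dot (take (size v') g) v') (+) (y && dot (take (size u') g) u')
      (+) bil (drop (size u') g) u' v'
  | _, _ => false
  end.

Lemma paddCA a b c : padd a (padd b c) = padd b (padd a c).
Proof. by rewrite !paddA (paddC a). Qed.

Lemma pantiI a : panti a PI = false. Proof. by case: a. Qed.

Lemma lin_bxor u v c : lin (bxor u v) c = padd (lin u c) (lin v c).
Proof.
elim: c u v => [|a c IHc] [|x u] [|y v] //=; first by case: (if x then _ else _).
rewrite IHc; case: x; case: y => //=.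
- by rewrite -paddA (paddCA (lin u c)) !paddA padda.
- by rewrite paddA.
by rewrite paddCA.
Qed.

Lemma bxorC u v : bxor u v = bxor v u.
Proof. by elim: u v => [|x u IHu] [|y v] //=; rewrite addbC IHu. Qed.

Lemma bxorA u v w : bxor u (bxor v w) = bxor (bxor u v) w.
Proof. by elim: u v w => [|x u IHu] [|y v] [|z w] //=; rewrite addbA IHu. Qed.

Lemma size_bxor u v : size (bxor u v) = maxn (size u) (size v).
Proof.
elim: u v => [|x u IHu] [|y v] //=; rewrite ?max0n ?maxn0 //.
by rewrite IHu maxnSS.
Qed.

Lemma take_bxor n u v : take n (bxor u v) = bxor (take n u) (take n v).
Proof.
elim: n u v => [|n IHn] [|x u] [|y v] //=; by rewrite ?IHn.
Qed.

Lemma drop_bxor n u v : drop n (bxor u v) = bxor (drop n u) (drop n v).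
Proof.
by elim: n u v => [|n IHn] [|x u] [|y v] //=; case: (drop n _).
Qed.

Lemma dot_bxorl u v w : dot (bxor u v) w = dot u w (+) dot v w.
Proof.
elim: w u v => [|z w IHw] [|x u] [|y v] //=; rewrite ?addbF //.
by rewrite IHw; case: x; case: y; case: z; case: (dot u w); case: (dot v w).
Qed.

Lemma bxorK u v : size u = size v -> bxor u (bxor u v) = v.
Proof. by elim: u v => [|x u IHu] [|y v] //= [/IHu->]; rewrite addKb. Qed.

Lemma bil_bxor g h u v : bil (bxor g h) u v = bil g u v (+) bil h u v.
Proof.
elim: u v g h => [|x u IHu] [|y v] g h //=.
rewrite !take_bxor drop_bxor !dot_bxorl IHu.
by rewrite !andb_addr (addbACA (x && _)) addbACA.
Qed.

Lemma bil_nil u v : bil [::] u v = false.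
Proof. by elim: u v => [|x u IHu] [|y v] //=; rewrite IHu !andbF. Qed.

Lemma dot_map_panti a c v : dot (map (panti a) c) v = panti a (lin v c).
Proof.
elim: c v => [|b c IHc] [|y v]  //=; rewrite ?pantiI //.
by rewrite IHc; case: y; rewrite ?andbT ?andbF ?panti_addr.
Qed.

Lemma panti_lin c u v : size u = size c -> size v = size c ->
  panti (lin u c) (lin v c) = bil (gram c) u v.
Proof.
elim: c u v => [|a c IHc] [|x u] [|y v] //= [su] [sv].
rewrite su sv /gram /= -/(gram c) !take_size_cat ?drop_size_cat ?size_map //.
rewrite !dot_map_panti -IHc //.
case: x; case: y; rewrite /= ?panti_addl ?panti_addr ?pantia ?addFb ?addbF //.
  by rewrite (pantiC (lin u c) a); do 3 case: (panti _ _).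
by rewrite pantiC.
Qed.

(** Anticommutation of words is the sum over positions, and [bil] is additive in its coefficients,
    so only the sum of the Gram vectors of the columns matters. *)
Lemma wanti_lin c u v : all (fun col => size col == 5) c ->
  size u = 5 -> size v = 5 ->
  wanti (map (lin u) c) (map (lin v) c) = bil (foldr bxor [::] (map gram c)) u v.
Proof.
move=> + su sv; elim: c => [|col c IHc] /=; first by rewrite bil_nil.
case/andP=> /eqP sc /IHc ->; rewrite bil_bxor panti_lin ?su ?sv //.
Qed.

(* The coordinates of the generators p, q, x, y, z, in this order. *)
Definition units : seq (seq bool) :=
  [seq [seq i == j | j <- iota 0 5] | i <- iota 0 5].

Definition points : seq (seq bool) := Eval vm_compute in
  let e := nth [::] units in
  units ++ [seq bxor u v | u <- [:: e 0; e 1], v <- [:: e 2; e 3; e 4]]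
  ++ [seq bxor (bxor (e 0) (e 1)) v | v <- [:: bxor (e 2) (e 3); bxor (e 2) (e 4);
        bxor (e 3) (e 4); bxor (e 2) (bxor (e 3) (e 4))]].

Definition nucleus : seq bool := [:: false; false; true; true; true].

(* The value of [gram] on (p, q, x, y, z): only pq, xy, xz and yz anticommute. *)
Definition gram0 : seq bool :=
  [:: true; false; false; false; false; false; false; true; true; true].

Definition anti (u v : seq bool) : bool := bil gram0 u v.

(** Requiring increasing positions in [points] lists each line only once. *)
Definition lines : seq (seq (seq bool)) := Eval vm_compute in
  [seq [:: t.1; t.2; bxor t.1 t.2] | t <- [seq (u, v) | u <- points, v <- points]
     & [&& ~~ anti t.1 t.2, bxor t.1 t.2 \in points
         & index t.1 points < index t.2 points < index (bxor t.1 t.2) points]].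

Definition valid (c : seq (seq pauli)) : bool :=
  all (fun col => size col == 5) c && (foldr bxor [::] (map gram c) == gram0).

Definition word N (c : N.-tuple (seq pauli)) (u : seq bool) : N.-tuple pauli :=
  [tuple of map (lin u) c].

Definition span_points N (c : N.-tuple (seq pauli)) : {set observable N} :=
  [set a : observable N | val a \in map (word c) points].

Lemma word_bxor N (c : N.-tuple (seq pauli)) u v :
  word c (bxor u v) = wadd (word c u) (word c v).
Proof.
apply: val_inj; case: c => c /= _; elim: c => //= col c ->.
by rewrite lin_bxor.
Qed.

Lemma size_points u : u \in points -> size u = 5.
Proof.
by move=> /(allP (isT : all (fun u => size u == 5) points)) /eqP.
Qed.

Lemma wanti_word N (c : N.-tuple (seq pauli)) u v :
  valid c -> size u = 5 -> size v = 5 ->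
  wanti (word c u) (word c v) = anti u v.
Proof. by case/andP=> sc /eqP gc su sv; rewrite wanti_lin ?gc. Qed.

Section Valid.
Variables (N : nat) (c : N.-tuple (seq pauli)).
Hypothesis vc : valid c.

(** Every point anticommutes with some point, whereas the identity word anticommutes with
    nothing. *)
Lemma word_neqI u : u \in points -> word c u != [tuple of nseq N PI].
Proof.
move=> pu; have su := size_points pu.
have /hasP[v pv uv] :=
  allP (isT : all (fun u => has (anti u) points) points) u pu.
apply: contraTneq uv => e.
by rewrite -(wanti_word vc su (size_points pv)) e wantiC wanti_nseqI.
Qed.

(** Distinct points differ in which points they anticommute with, so their words differ even when
    the nucleus vanishes. *)
Lemma word_inj : {in points &, injective (word c)}.
Proof.
move=> u v pu pv e.
have := allP (isT : all (fun u => all (fun v =>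
  all (fun t => anti u t == anti v t) points ==> (u == v)) points) points) u pu.
move/allP/(_ v pv)/implyP=> h; apply/eqP/h/allP=> t pt.
by rewrite -!(wanti_word vc) ?size_points // e.
Qed.
End Valid.

(** * Doilies from configurations *)

Section FinsetOfSeq.
Variable T : finType.
Implicit Types (s : seq T) (P : pred T).

Lemma card_seq_set s : uniq s -> #|[set x in s]| = size s.
Proof. by move=> us; rewrite cardsE; apply/card_uniqP. Qed.

Lemma card_seq_set_count s P : uniq s ->
  #|[set x in [set y in s] | P x]| = count P s.
Proof.
move=> us; have -> : [set x in [set y in s] | P x] = [set x in filter P s].
  by apply/setP=> x; rewrite !inE mem_filter andbC.
by rewrite card_seq_set ?filter_uniq // size_filter.
Qed.
End FinsetOfSeq.

Definition acol (u v : seq bool) : bool :=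
  has (fun l => (u \in l) && (v \in l)) lines.

(** * The model quadrangle transported along an injection *)

Section Transport.
Variables (T : finType) (f : seq bool -> T).
Hypothesis f_inj : {in points &, injective f}.

Definition seg (l : seq (seq bool)) : {set T} := [set x in map f l].

Definition line_sets : {set {set T}} := [set l in map seg lines].

Lemma lines_sub l u : l \in lines -> u \in l -> u \in points.
Proof. by move/(allP (isT : all (all (mem points)) lines))/allP; exact. Qed.

Lemma mem_seg l u : l \in lines -> u \in points -> (f u \in seg l) = (u \in l).
Proof.
move=> hl hu; rewrite in_set; apply/mapP/idP => [[v hv] | h]; last by exists u.
by move/f_inj=> -> //; apply: lines_sub hv.
Qed.

Lemma uniq_map_in l : l \in lines -> uniq (map f l).
Proof.
move=> hl; rewrite map_inj_in_uniq; first exact: (allP (isT : all uniq lines)).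
by move=> u v hu hv; apply: f_inj; apply: (lines_sub hl).
Qed.

(** No line of the model contains another, so the image of a line determines it. *)
Lemma uniq_segs : uniq (map seg lines).
Proof.
rewrite map_inj_in_uniq // => l l' hl hl' e.
have := allP (allP (isT : all (fun l => all (fun l' =>
  all (mem l') l ==> (l == l')) lines) lines) l hl) l' hl'.
move/implyP=> h; apply/eqP/h/allP=> u hu.
have pu := lines_sub hl hu.
by change (u \in l'); rewrite -(mem_seg hl' pu) -e mem_seg.
Qed.

Lemma collinear_acol u v : u \in points -> v \in points ->
  collinear line_sets (f u) (f v) = acol u v.
Proof.
move=> hu hv; apply/existsP/hasP=> [[S]|[l hl h]].
  rewrite in_set => /andP[/mapP[l hl ->]]; rewrite !mem_seg // => h.
  by exists l.
by exists (seg l); rewrite !mem_seg // h andbT in_set map_f.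
Qed.

(** Injectivity turns each axiom into a count over the concrete lists [points] and [lines], which is
    settled by computation. *)
Lemma points_GQ22 : is_GQ22 [set x in map f points] line_sets.
Proof.
have up : uniq (map f points) by rewrite map_inj_in_uniq.
apply/and5P; split.
- by rewrite card_seq_set ?size_map.
- by rewrite card_seq_set ?size_map ?uniq_segs.
- apply/forall_inP=> S; rewrite in_set => /mapP[l hl ->]; apply/andP; split.
    apply/subsetP=> x; rewrite !in_set => /mapP[u hu ->]; apply: map_f.
    exact: lines_sub hu.
  rewrite card_seq_set ?uniq_map_in // size_map.
  exact: (allP (isT : all (fun l => size l == 3) lines)).
- apply/forall_inP=> x; rewrite in_set => /mapP[u hu ->].
  rewrite card_seq_set_count ?uniq_segs // count_map.
  rewrite (@eq_in_count _ _ (fun l : seq (seq bool) => u \in l)); last first.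
    by move=> l hl /=; rewrite mem_seg.
  exact: (allP (isT : all (fun u => count (fun l => u \in l) lines == 3) points)).
apply/forall_inP=> x; rewrite in_set => /mapP[u hu ->].
apply/forall_inP=> S; rewrite in_set => /mapP[l hl ->].
rewrite mem_seg //; apply/implyP=> nul.
rewrite card_seq_set_count ?uniq_map_in // count_map.
rewrite (@eq_in_count _ _ (acol u)); last first.
  by move=> v hv; rewrite [LHS]collinear_acol ?(lines_sub hl hv).
have := allP (allP (isT : all (fun u => all (fun l =>
  (u \notin l) ==> (count (acol u) l == 1)) lines) points) u hu) l hl.
by rewrite nul.
Qed.
End Transport.

Section ValidDoily.
Variables (N : nat) (c : N.-tuple (seq pauli)).
Hypothesis vc : valid c.

Lemma point_obs_exists : exists f : seq bool -> observable N,
  {in points, forall u, val (f u) = word c u}.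
Proof.
pose nonI (w : N.-tuple pauli) := w != [tuple of nseq N PI].
(* [insubd] needs a default observable; the word of the first point supplies one. *)
have h0 : nonI (word c (head [::] points)) := word_neqI vc (mem_head _ _).
exists (fun u => insubd (exist nonI _ h0 : observable N) (word c u)) => u hu.
by rewrite val_insubd word_neqI.
Qed.

Lemma span_pointsE (f : seq bool -> observable N) :
  {in points, forall u, val (f u) = word c u} ->
  span_points c = [set x in map f points].
Proof.
move=> fE; apply/setP=> a; rewrite !in_set; apply/mapP/mapP.
all: move=> [u hu e]; exists u => //.
  by apply: val_inj; rewrite fE.
by rewrite e fE.
Qed.

Lemma point_obs_inj (f : seq bool -> observable N) :
  {in points, forall u, val (f u) = word c u} -> {in points &, injective f}.
Proof. by move=> fE u v hu hv e; apply: (word_inj vc) => //; rewrite -!fE ?e. Qed.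

Lemma span_points_doily : is_doily (span_points c).
Proof.
have [f fE] := point_obs_exists; have fI := point_obs_inj fE.
have wE u v : u \in points -> v \in points ->
    wanti (val (f u)) (val (f v)) = anti u v.
  by move=> hu hv; rewrite !fE // (wanti_word vc) ?size_points.
apply/existsP; exists (line_sets f); rewrite (span_pointsE fE).
apply/and3P; split; first exact: points_GQ22.
- apply/forall_inP=> x; rewrite in_set => /mapP[u hu ->].
  apply/forall_inP=> y; rewrite in_set => /mapP[v hv ->]; apply/implyP=> _.
  rewrite /obs_mx comm_word_mx wE // collinear_acol //.
  exact: (allP (allP (isT : all (fun u => all (fun v =>
    ~~ anti u v == acol u v) points) points) u hu) v hv).
apply/forall_inP=> S; rewrite in_set => /mapP[l hl ->].
have hp := @lines_sub l; have hL := lines_sub hl.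
apply/forall_inP=> x; rewrite in_set => /mapP[u hu ->].
apply/forall_inP=> y; rewrite in_set => /mapP[v hv ->].
apply/forall_inP=> z; rewrite in_set => /mapP[w hw ->].
apply/implyP=> uq.
have := allP (allP (allP (allP (isT : all (fun l => all (fun u => all (fun v =>
  all (fun w => uniq [:: u; v; w] ==> ~~ anti u v && (w == bxor u v)) l) l) l)
  lines) l hl) u hu) v hv) w hw.
have -> : uniq [:: u; v; w].
  by move: uq; rewrite /= !inE !(inj_in_eq fI) ?hL.
case/andP=> nuv /eqP ew; rewrite /obs_mx word_mx_prodP ?wE ?hL //.
by rewrite !fE ?hL // ew word_bxor.
Qed.
End ValidDoily.

(** * Configurations from doilies *)

Section DoilyBasis.
Variables (N : nat) (D : {set observable N}) (L : {set {set observable N}}).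
Hypothesis DL : is_doily_with D L.

Lemma doily_card : #|D| = 15.
Proof. by case/and3P: DL => /and5P[/eqP]. Qed.

Lemma doily_line l : l \in L -> l \subset D /\ #|l| = 3.
Proof.
by case/and3P: DL => /and5P[_ _ /forall_inP h _ _] _ _ /h/andP[-> /eqP].
Qed.

Lemma doily_collinear a b : a \in D -> b \in D -> a != b ->
  collinear L a b = ~~ wanti (val a) (val b).
Proof.
case/and3P: DL => _ /forall_inP h _ aD bD ab.
by have /forall_inP/(_ b bD)/implyP/(_ ab)/eqP <- := h a aD; rewrite comm_word_mx.
Qed.

Lemma collinearP a b :
  reflect (exists2 l, l \in L & (a \in l) && (b \in l)) (collinear L a b).
Proof. exact: exists_inP. Qed.

Lemma line_commute l a b : l \in L -> a \in l -> b \in l -> a != b ->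
  ~~ wanti (val a) (val b).
Proof.
move=> lL al bl ab; have [/subsetP lD _] := doily_line lL.
by rewrite -doily_collinear ?lD //; apply/collinearP; exists l; rewrite ?al.
Qed.

(** The product condition forces the third point of a line to be the sum of the other two, so two
    points determine their line. *)
Lemma line_third l a b : l \in L -> a \in l -> b \in l -> a != b ->
  exists2 d, val d = wadd (val a) (val b) & l = [set a; b; d].
Proof.
move=> lL al bl ab; have [_ l3] := doily_line lL.
have : 0 < #|l :\: [set a; b]|.
  by rewrite cardsDS ?cards2 ?ab ?l3 // subUset !sub1set al bl.
case/card_gt0P=> d; rewrite !inE negb_or => /andP[/andP[da db] dl].
exists d; last first.
  apply/esym/eqP; rewrite eqEcard !subUset !sub1set al bl dl l3.
  by rewrite setUC cardsU1 cards2 !inE negb_or da db ab.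
case/and3P: DL => _ _ /forall_inP/(_ l lL)/forall_inP/(_ a al).
move=> /forall_inP/(_ b bl)/forall_inP/(_ d dl)/implyP.
rewrite /= !inE negb_or ab ![_ == d]eq_sym da db => /(_ isT).
by rewrite word_mx_prodP => [/eqP|]; last exact: (line_commute lL).
Qed.

Lemma line_unique l m a b : l \in L -> m \in L -> a != b ->
  a \in l -> b \in l -> a \in m -> b \in m -> l = m.
Proof.
move=> lL mL ab al bl am bm.
have [d dE ->] := line_third lL al bl ab.
have [e eE ->] := line_third mL am bm ab.
by have -> : d = e by apply: val_inj; rewrite dE eE.
Qed.

Lemma doily_add a b : a \in D -> b \in D -> a != b -> ~~ wanti (val a) (val b) ->
  exists2 d, d \in D & val d = wadd (val a) (val b).
Proof.
move=> aD bD ab; rewrite -doily_collinear // => /collinearP[l lL /andP[al bl]].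
have [d dE lE] := line_third lL al bl ab; exists d => //.
by have [/subsetP-> //] := doily_line lL; rewrite lE !inE eqxx orbT.
Qed.

Lemma line_projection p l : p \in D -> l \in L -> p \notin l ->
  exists2 q, q \in l & forall r, r \in l -> collinear L p r = (r == q).
Proof.
case/and3P: DL => /and5P[_ _ _ _ /forall_inP h] _ _ pD lL pl.
have /forall_inP/(_ l lL)/implyP/(_ pl)/cards1P[q qE] := h p pD.
have hq r : (r \in l) && collinear L p r = (r == q).
  by have := congr1 (fun A : {set _} => r \in A) qE; rewrite !inE.
exists q; first by have := hq q; rewrite eqxx => /andP[].
by move=> r rl; rewrite -hq rl.
Qed.

(* q is an observable that anticommutes with p, and x, y and z are the feet of
   q on the three lines through p. *)
Lemma doily_frame : exists p q x y z : observable N,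
  [/\ all (mem D) [:: p; q; x; y; z],
      [&& wanti (val p) (val q), wanti (val x) (val y),
          wanti (val x) (val z) & wanti (val y) (val z)]
    & all (fun t : observable N =>
        ~~ wanti (val p) (val t) && ~~ wanti (val q) (val t)) [:: x; y; z]].
Proof.
case/and3P: (DL) => /and5P[_ /eqP L15 _ /forall_inP D3 _] _ _.
have /card_gt0P[l lL] : 0 < #|L| by rewrite L15.
have [/subsetP lD l3] := doily_line lL.
have : 0 < #|D :\: l| by rewrite cardsDS ?doily_card ?l3 //; apply/subsetP.
case/card_gt0P=> p; rewrite inE => /andP[pl pD].
(* [q0] is the only point of [l] collinear with [p]; any other point of [l] can serve as [q]. *)
have [q0 q0l q0P] := line_projection pD lL pl.
have : 0 < #|l :\: [set q0]| by rewrite cardsDS ?cards1 ?l3 // sub1set.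
case/card_gt0P=> q; rewrite !inE => /andP[qq0 ql].
have qD := lD q ql.
have ncpq : ~~ collinear L p q by rewrite q0P.
have pq : p != q by apply: contraNneq pl => ->.
have /card_gt2P[l1 [l2 [l3' [[]]]]] : 2 < #|[set m in L | p \in m]|.
  by rewrite (eqP (D3 p pD)).
rewrite !inE => /andP[m1L pm1] /andP[m2L pm2] /andP[m3L pm3] [m12 m23 m31].
have foot m : m \in L -> p \in m -> exists x : observable N,
    [/\ x \in m, x \in D, x != p, ~~ wanti (val p) (val x) & ~~ wanti (val q) (val x)].
  move=> mL pm; have [/subsetP mD _] := doily_line mL.
  have qm : q \notin m.
    by apply: contra ncpq => qm; apply/collinearP; exists m; rewrite ?pm.
  have [x xm xP] := line_projection qD mL qm.
  have cqx : collinear L q x by rewrite xP.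
  have xp : x != p.
    apply: contraNneq ncpq => <-; apply/collinearP.
    by case/collinearP: cqx => k kL /andP[a b]; exists k; rewrite ?b.
  have xq : q != x by apply: contraNneq qm => ->.
  have px : p != x by rewrite eq_sym.
  exists x; split; rewrite ?mD //; first exact: (line_commute mL).
  by rewrite -doily_collinear // mD.
have [x [xm xD xp px qx]] := foot _ m1L pm1.
have [y [ym yD yp py qy]] := foot _ m2L pm2.
have [z [zm zD zp pz qz]] := foot _ m3L pm3.
(* The foot of [v] on [m] is [p], so [v] is not collinear with the other point [u] of [m]. *)
have feet m n u v : m \in L -> n \in L -> p \in m -> p \in n -> m != n ->
    u \in m -> v \in n -> u \in D -> v \in D -> u != p -> v != p ->
    wanti (val u) (val v).
  move=> mL nL pm pn mn um vn uD vD up vp.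
  have vm : v \notin m.
    by apply: contra mn => vm; apply/eqP/(line_unique mL nL vp).
  have uv : u != v by apply: contraNneq vm => <-.
  have [w wm wP] := line_projection vD mL vm.
  have : collinear L v p by apply/collinearP; exists n; rewrite ?vn.
  rewrite wP // => /eqP pw; subst w.
  have := wP u um; rewrite (negPf up) doily_collinear // 1?eq_sym //.
  by rewrite wantiC => /negbFE.
have m13 : l1 != l3' by rewrite eq_sym.
exists p, q, x, y, z; split.
- by rewrite /= pD qD xD yD zD.
- rewrite (feet l1 l2 x y) // (feet l2 l3' y z) // (feet l1 l3' x z) // !andbT.
  by apply: contraNT ncpq; rewrite -doily_collinear.
by apply/allP=> t; rewrite !inE => /or3P[] /eqP ->; apply/andP.
Qed.

(** A doily is closed under sums of distinct commuting points. Starting from the five generators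
    this yields all 15 points, and cardinality gives equality. *)
Lemma doily_span (c : N.-tuple (seq pauli)) : valid c ->
  {in units, forall u, exists2 a, a \in D & val a = word c u} ->
  D = span_points c.
Proof.
move=> vc hu.
have [f fE] := point_obs_exists vc; have fI := point_obs_inj vc fE.
have fD u v w : [&& u \in points, v \in points, w \in points, u != v, ~~ anti u v
    & w == bxor u v] -> f u \in D -> f v \in D -> f w \in D.
  case/and5P=> pu pv pw uv /andP[nuv /eqP ew] uD vD.
  have [||d dD dE] := doily_add uD vD; first by rewrite (inj_in_eq fI).
    by rewrite !fE // (wanti_word vc) ?size_points.
  suff -> : f w = d by [].
  by apply: val_inj; rewrite dE !fE // ew word_bxor.
have fU u : u \in take 5 points -> f u \in D.
  move=> uu; have [a aD aE] := hu u uu; suff -> : f u = a by [].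
  by apply: val_inj; rewrite aE fE // (mem_take uu).
pose e := nth [::] points.
have fP : {in points, forall u, f u \in D}.
  suff: all (fun u => f u \in D) points by move/allP.
  have U0 := fU (e 0) isT; have U1 := fU (e 1) isT; have U2 := fU (e 2) isT.
  have U3 := fU (e 3) isT; have U4 := fU (e 4) isT.
  (* Each further point is a sum of two commuting points already obtained; for example p + q + x + y
     arises from p + x and q + y. *)
  have U5 := fD (e 0) (e 2) (e 5) isT U0 U2.
  have U6 := fD (e 0) (e 3) (e 6) isT U0 U3.
  have U7 := fD (e 0) (e 4) (e 7) isT U0 U4.
  have U8 := fD (e 1) (e 2) (e 8) isT U1 U2.
  have U9 := fD (e 1) (e 3) (e 9) isT U1 U3.
  have U10 := fD (e 1) (e 4) (e 10) isT U1 U4.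
  have U11 := fD (e 5) (e 9) (e 11) isT U5 U9.
  have U12 := fD (e 5) (e 10) (e 12) isT U5 U10.
  have U13 := fD (e 6) (e 10) (e 13) isT U6 U10.
  have U14 := fD (e 11) (e 4) (e 14) isT U11 U4.
  by rewrite /= U0 U1 U2 U3 U4 U5 U6 U7 U8 U9 U10 U11 U12 U13 U14.
apply/esym/eqP; rewrite (span_pointsE fE) eqEcard; apply/andP; split.
  by apply/subsetP=> a; rewrite in_set => /mapP[u uP ->]; apply: fP.
rewrite doily_card card_seq_set; first by rewrite size_map.
by rewrite map_inj_in_uniq.
Qed.
End DoilyBasis.

Definition columns N (ws : seq (N.-tuple pauli)) : N.-tuple (seq pauli) :=
  [tuple [seq tnth w i | w <- ws] | i < N].

Lemma lin_unit k (c : seq pauli) : size c = 5 -> k < 5 ->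
  lin (nth [::] units k) c = nth PI c k.
Proof.
case: c => [|a [|b [|c [|d [|e []]]]]] // _.
by case: k => [|[|[|[|[|k]]]]] // _; case: a b c d e => [] [] [] [] [].
Qed.

Lemma word_columns N (ws : seq (N.-tuple pauli)) k w0 : size ws = 5 -> k < 5 ->
  word (columns ws) (nth [::] units k) = nth w0 ws k.
Proof.
move=> sw k5; apply: eq_from_tnth => i; rewrite tnth_map tnth_mktuple.
by rewrite lin_unit ?size_map // (nth_map w0) // sw.
Qed.

Lemma size_bxors g : all (fun col => size col == 5) g ->
  size (foldr bxor [::] (map gram g)) = if g is [::] then 0 else 10.
Proof.
elim: g => //= col g IHg /andP[sc /IHg sg]; rewrite size_bxor sg.
by case: col sc => [|a [|b [|c [|d [|e []]]]]] //; case: (g).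
Qed.

(** Evaluating the summed Gram form on pairs of unit vectors returns its ten coefficients one by
    one. *)
Lemma valid_columns N (ws : seq (N.-tuple pauli)) :
  size ws = 5 -> pairing (fun u v : N.-tuple pauli => wanti u v) ws = gram0 ->
  valid (columns ws).
Proof.
case: ws => [|w0 [|w1 [|w2 [|w3 [|w4 []]]]]] // _.
set ws := [:: _; _; _; _; _] => gw; set c := columns ws.
have wk k := @word_columns N ws k w0 (erefl _).
rewrite -/c in wk.
have sc : all (fun col => size col == 5) c by apply/allP=> col /codomP[i ->].
rewrite /valid sc /=.
have gE i j : i < 5 -> j < 5 -> bil (foldr bxor [::] (map gram c))
    (nth [::] units i) (nth [::] units j) = wanti (nth w0 ws i) (nth w0 ws j).
  move=> i5 j5; rewrite -!wk // wanti_lin //.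
    by move: i i5 => [|[|[|[|[]]]]].
  by move: j j5 => [|[|[|[|[]]]]].
have : size (foldr bxor [::] (map gram c)) = 10.
  rewrite size_bxors //; case E: (tval c) => //.
  (* Without columns the sum is [[::]] instead of ten entries, but then no two words anticommute,
     contrary to [gram0]. *)
  have N0 : N = 0 by rewrite -(size_tuple c) E.
  by move: gw; subst N; rewrite /= (tuple0 w0).
case: gw => g01 g02 g03 g04 g12 g13 g14 g23 g24 g34.
move: (gE 0 1 isT isT) (gE 0 2 isT isT) (gE 0 3 isT isT) (gE 0 4 isT isT)
  (gE 1 2 isT isT) (gE 1 3 isT isT) (gE 1 4 isT isT)
  (gE 2 3 isT isT) (gE 2 4 isT isT) (gE 3 4 isT isT) => /=.
rewrite g01 g02 g03 g04 g12 g13 g14 g23 g24 g34.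
case: (foldr _ _ _)
  => [|b0 [|b1 [|b2 [|b3 [|b4 [|b5 [|b6 [|b7 [|b8 [|b9 []]]]]]]]]]] //=.
rewrite !addbF ?andbF /= ?addbF ?andbT.
by do 10 move=> ->.
Qed.

Lemma doily_config N (D : {set observable N}) : is_doily D ->
  exists2 c : N.-tuple (seq pauli), valid c & D = span_points c.
Proof.
case/existsP=> L DL; have [p [q [x [y [z [hD h1 h0]]]]]] := doily_frame DL.
pose ws := [:: val p; val q; val x; val y; val z].
have vc : valid (columns ws).
  apply: valid_columns => //.
  case/and4P: h1 => pq xy xz yz.
  case/and4P: h0 => /andP[px qx] /andP[py qy] /andP[pz qz] _.
  rewrite /= pq xy xz yz (negPf px) (negPf qx) (negPf py) (negPf qy).
  by rewrite (negPf pz) (negPf qz).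
exists (columns ws) => //; apply: (doily_span DL vc) => u /(nthP [::])[k k5 <-].
rewrite (word_columns (val p)) //; move/allP: hD => hD.
exists (nth p [:: p; q; x; y; z] k); first by apply/hD/mem_nth.
by case: k k5 => [|[|[|[|[]]]]].
Qed.

(** * The type of a configuration *)

Section Vectors.
Local Open Scope ring_scope.

Lemma pauli_bits_add a b :
  pauli_bits (padd a b)
  = ((pauli_bits a).1 + (pauli_bits b).1, (pauli_bits a).2 + (pauli_bits b).2).
Proof. by case: a; case: b; congr pair; apply/val_inj. Qed.

Lemma word_vec_add N (u v : N.-tuple pauli) :
  word_vec (wadd u v) = word_vec u + word_vec v.
Proof.
apply/rowP=> j; rewrite !mxE.
have uvE i : tnth (wadd u v) i = padd (tnth u i) (tnth v i).
  rewrite (tnth_nth PI) /= (nth_map (PI, PI)) ?size_zip ?size_tuple ?minnn //.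
  by rewrite nth_zip ?size_tuple //= -!tnth_nth.
by case: split => i; rewrite !mxE uvE pauli_bits_add.
Qed.

Lemma word_vec_eq0 N (w : N.-tuple pauli) :
  (word_vec w == 0) = (w == [tuple of nseq N PI]).
Proof.
apply/eqP/eqP=> [w0|->].
  apply: eq_from_tnth => i; rewrite (tnth_nth PI (nseq_tuple _ _)) nth_nseq ltn_ord.
  apply: (can_inj pauli_bitsK); move/rowP: w0 => w0.
  have := w0 (lshift N i); have := w0 (rshift N i).
  rewrite /word_vec row_mxEl row_mxEr !mxE.
  by case: (pauli_bits _) => ? ? /= -> ->.
apply/rowP=> j; rewrite !mxE; case: split => i;
  by rewrite !mxE (tnth_nth PI) nth_nseq ltn_ord.
Qed.

Lemma F2_bool (x : 'F_2) : x = (x != 0)%:R.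
Proof. by case: x => [[|[|m]] hm] //; apply: val_inj. Qed.

Section Span.
Variables (N : nat) (c : N.-tuple (seq pauli)).
Hypothesis vc : valid c.
Let vec u := word_vec (word c u).
Let e i := nth [::] units i.

Lemma vec_bxor u v : vec (bxor u v) = vec u + vec v.
Proof. by rewrite /vec word_bxor word_vec_add. Qed.

Lemma vec_scale (b : bool) i : b%:R *: vec (e i) = vec (map (andb b) (e i)).
Proof.
case: b; first by rewrite scale1r -[in LHS](map_id (e i)).
rewrite scale0r; apply/esym/eqP; rewrite word_vec_eq0; apply/eqP/eq_from_tnth=> j.
rewrite tnth_map (tnth_nth PI) nth_nseq ltn_ord.
elim: (e i) (tnth c j) => [|x u IHu] [|a col] //=; exact: IHu.
Qed.

Lemma vec_coords b0 b1 b2 b3 b4 :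
  vec [:: b0; b1; b2; b3; b4]
  = b0%:R *: vec (e 0) + (b1%:R *: vec (e 1) + (b2%:R *: vec (e 2)
    + (b3%:R *: vec (e 3) + b4%:R *: vec (e 4)))).
Proof.
rewrite !vec_scale -!vec_bxor; congr vec.
by case: b0; case: b1; case: b2; case: b3; case: b4.
Qed.

(** A vanishing combination anticommutes with no point, hence lies in the radical of [anti], which
    consists of zero and the nucleus. *)
Lemma vec_eq0 u : size u = 5%N -> vec u = 0 ->
  (u == [:: false; false; false; false; false]) || (u == nucleus).
Proof.
move=> su /eqP; rewrite word_vec_eq0 => /eqP u0.
have h : all (fun v => ~~ anti u v) points.
  apply/allP=> v pv; rewrite -(wanti_word vc su (size_points pv)) u0.
  by rewrite wantiC wanti_nseqI.
move: u su h {u0} => [|[] [|[] [|[] [|[] [|[] []]]]]] //.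
Qed.

(** The only possible nontrivial relation is x + y + z = 0. The side condition excludes it in both
    cases: the nucleus is nonzero, or z does not occur. *)
Lemma vec_coords_eq0 (k0 k1 k2 k3 k4 : 'F_2) :
  k0 *: vec (e 0) + (k1 *: vec (e 1) + (k2 *: vec (e 2)
    + (k3 *: vec (e 3) + k4 *: vec (e 4)))) = 0 ->
  (vec nucleus != 0) || (k4 == 0) -> [/\ k0 = 0, k1 = 0, k2 = 0, k3 = 0 & k4 = 0].
Proof.
rewrite [k0]F2_bool [k1]F2_bool [k2]F2_bool [k3]F2_bool [k4]F2_bool -vec_coords.
move: (k0 != 0) (k1 != 0) (k2 != 0) (k3 != 0) (k4 != 0) => b0 b1 b2 b3 b4 v0.
have := @vec_eq0 [:: b0; b1; b2; b3; b4] (erefl _) v0.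
case/orP=> /eqP e0; first by case: e0 => -> -> -> -> ->.
by rewrite -e0 v0 eqxx /=; case: e0 => -> -> -> -> ->.
Qed.

Lemma span_dim_units : span_dim (span_points c) = \dim <<map vec units>>.
Proof.
congr (\dim _); have [f fE] := point_obs_exists vc; apply/eqP.
rewrite eqEsubv; apply/andP; split; apply/span_subvP => v.
  case/imageP=> a; rewrite in_set => /mapP[u pu] au ->; rewrite /obs_vec au.
  have := size_points pu; case: u {pu au} => [|b0 [|b1 [|b2 [|b3 [|b4 []]]]]] // _.
  rewrite -/(vec _) vec_coords.
  by rewrite !memvD ?memvZ ?memv_span ?map_f.
case/mapP=> u uu ->; have pu : u \in points by apply: (@mem_take 5).
apply/memv_span/imageP; exists (f u); last by rewrite /obs_vec fE.
by rewrite (span_pointsE fE) in_set map_f.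
Qed.

Lemma span_dim_quadratic : vec nucleus != 0 -> span_dim (span_points c) = 5%N.
Proof.
move=> n0; rewrite span_dim_units; apply/eqP.
(* [free] is by definition the equality of the dimension of the span with the length. *)
change (free (map_tuple vec [tuple of units])).
apply/freeP=> k; rewrite !big_ord_recl big_ord0 addr0 => /vec_coords_eq0.
rewrite n0 => /(_ isT) [k0 k1 k2 k3 k4].
by case=> [[|[|[|[|[|i]]]]]] // hi;
  [rewrite -k0|rewrite -k1|rewrite -k2|rewrite -k3|rewrite -k4];
  congr k; apply: val_inj.
Qed.

Lemma span_dim_linear : vec nucleus = 0 -> span_dim (span_points c) = 4%N.
Proof.
move=> n0; rewrite span_dim_units.
have -> : (<<map vec units>> = <<map vec (take 4 units)>>)%VS.
  apply/eqP; rewrite eqEsubv; apply/andP; split; last first.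
    by apply: sub_span => v /mapP[u /mem_take uu ->]; apply: map_f.
  have /allP h : all (fun v => v \in <<map vec (take 4 units)>>%VS) (map vec units).
    have : vec nucleus = vec (e 2) + (vec (e 3) + vec (e 4)).
      by rewrite -!vec_bxor.
    (* The vanishing nucleus expresses z through x and y, so four generators suffice. *)
    rewrite n0 addrA => /esym/addr0_eq e4.
    rewrite /= -e4 !memvN !memvD ?memv_span ?inE ?eqxx ?orbT //.
  by apply/span_subvP=> v; apply: h.
apply/eqP; change (free (map_tuple vec [tuple of take 4 units])).
apply/freeP=> k; rewrite !big_ord_recl big_ord0 addr0 => h.
have := @vec_coords_eq0 (k ord0) (k (lift ord0 ord0)) (k (lift ord0 (lift ord0 ord0)))
  (k (lift ord0 (lift ord0 (lift ord0 ord0)))) 0.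
rewrite scale0r addr0 eqxx orbT => /(_ h isT) [k0 k1 k2 k3 _].
by case=> [[|[|[|[|i]]]]] // hi; [rewrite -k0|rewrite -k1|rewrite -k2|rewrite -k3];
  congr k; apply: val_inj.
Qed.

Lemma character_span :
  character (span_points c)
  = Some (character_of_bool (word c nucleus == [tuple of nseq N PI])).
Proof.
rewrite /character -word_vec_eq0; have [n0|n0] := eqVneq (vec nucleus) 0.
  by rewrite span_dim_linear // n0 eqxx.
by rewrite span_dim_quadratic // (negPf n0).
Qed.
End Span.
End Vectors.

(** * Signature and character from weights *)

Definition is_I (a : pauli) : bool := if a is PI then true else false.

Lemma is_IE a : is_I a = (a == PI). Proof. by case: a; apply/esym/eqP. Qed.

(* The entry at index 0 belongs to the nucleus, those at 1, ..., 15 to the points. *)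
Definition weights (c : seq pauli) : seq nat :=
  [seq nat_of_bool (~~ is_I (lin u c)) | u <- nucleus :: points].

Fixpoint addv (u v : seq nat) : seq nat :=
  match u, v with
  | [::], _ => v
  | _, [::] => u
  | x :: u', y :: v' => x + y :: addv u' v'
  end.

(** Flag 1 for linear and 0 for quadratic, followed by the numbers of points of weight 1, 2, and so
    on; [behead] drops the count of weight 0. A flat list of numbers can serve as a trie key. *)
Definition code N (w : seq nat) : seq nat :=
  nat_of_bool (head 0 w == 0)
  :: behead (foldr (fun j v => incr_nth v j) (nseq N.+1 0) (behead w)).

Definition config_code N (c : seq (seq pauli)) :=
  code N (foldr addv [::] (map weights c)).

Definition decode N (s : seq nat) : N.-tuple nat * option doily_character :=
  ([tuple nth 0 s k.+1 | k < N], Some (character_of_bool (head 0 s == 1))).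

Lemma addv_nil s : addv s [::] = s. Proof. by case: s. Qed.

Lemma total_weights c : c != [::] -> foldr addv [::] (map weights c)
  = [seq count (fun col => ~~ is_I (lin u col)) c | u <- nucleus :: points].
Proof.
elim: c => // col [|col' c] IHc _.
  change (addv (weights col) [::] = [seq count (fun col => ~~ is_I (lin u col)) [:: col]
    | u <- nucleus :: points]).
  by rewrite addv_nil; apply: eq_map => u /=; rewrite addn0.
change (foldr addv [::] (map weights [:: col, col' & c]))
  with (addv (weights col) (foldr addv [::] (map weights (col' :: c)))).
by rewrite IHc.
Qed.

Lemma nth_foldr_incr_nth v0 s k :
  nth 0 (foldr (fun j v => incr_nth v j) v0 s) k = nth 0 v0 k + count_mem k s.
Proof.
by elim: s => [|j s IHs] /=; rewrite ?addn0 // nth_incr_nth IHs addnCA.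
Qed.

Lemma nth_code N w k : nth 0 (code N w) k.+1 = count_mem k.+1 (behead w).
Proof.
by rewrite [LHS]nth_behead nth_foldr_incr_nth (nth_nseq 0 N.+1) if_same.
Qed.

(** The letters I in a word and its weight add up to N, so the signature counts points by weight,
    and the nucleus vanishes iff its weight is 0. *)
Lemma doily_type_span N (c : N.-tuple (seq pauli)) : valid c ->
  doily_type (span_points c) = decode N (config_code N c).
Proof.
move=> vc; have cN : tval c != [::] by case/andP: vc => _; apply: contraTneq => ->.
have countE u : count_mem PI (word c u) + count (fun col => ~~ is_I (lin u col)) c = N.
  rewrite count_map -[RHS](size_tuple c) -(count_predC (fun col => is_I (lin u col))).
  by congr (_ + _); apply: eq_count => col; rewrite /= is_IE.
rewrite /doily_type /decode /config_code total_weights //; congr pair; last first.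
  rewrite character_span //; congr (Some (character_of_bool _)).
  have -> : (word c nucleus == [tuple of nseq N PI])
      = (count_mem PI (word c nucleus) == N).
    rewrite -[X in _ = (_ == X)](size_tuple (word c nucleus)) -all_count.
    apply/eqP/all_pred1P => [->|]; first by rewrite /= size_nseq.
    by rewrite [size _]size_tuple => e; apply: val_inj.
  rewrite [head 0 _]/= eqb1.
  change ((count_mem PI (word c nucleus) == N)
    = (count (fun col => ~~ is_I (lin nucleus col)) c == 0)).
  by have := countE nucleus; lia.
apply: eq_from_tnth => k; rewrite !tnth_mktuple nth_code behead_map.
have [f fE] := point_obs_exists vc; have fI := point_obs_inj vc fE.
rewrite (span_pointsE fE) card_seq_set_count ?map_inj_in_uniq // count_map.
rewrite [RHS]count_map; apply: eq_in_count => u pu /=; rewrite fE //.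
have := countE u; have := ltn_ord k.
by move: (nat_of_ord k) (count_mem PI _) (count _ c) => i a b; lia.
Qed.

(** * Enumeration of configurations *)

Definition all_columns (n : nat) : seq (seq pauli) :=
  iter n (fun s => [seq a :: c | a <- [:: PI; PX; PY; PZ], c <- s]) [:: [::]].

(** All that validity and the type depend on, for a column of five letters. *)
Definition profile (c : seq pauli) : seq bool * seq nat := (gram c, weights c).

Definition rebase (g : seq (seq bool)) (c : seq pauli) : seq pauli :=
  [seq lin u c | u <- g].

Definition frame (g : seq (seq bool)) : bool :=
  [&& size g == 5, all (mem points) g & pairing anti g == gram0].

Definition reps : seq (seq pauli) := Eval vm_compute in
  foldr (fun c s => if profile c \in map profile s then s else c :: s) [::]
    (all_columns 5).

(** Built from z back to p: each partial list must have the relations of the last generators, which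
    prunes the search early. *)
Definition frames : seq (seq (seq bool)) := Eval vm_compute in
  iter 5 (fun s => [seq g <- [seq u :: g | u <- points, g <- s]
    | pairing anti g == pairing anti (drop (5 - size g) units)]) [:: [::]].

(** Greedy choice: a column is dropped when some rebasing of it has a profile already kept. *)
Definition orbit_reps (gs : seq (seq (seq bool))) : seq (seq pauli) :=
  foldr (fun c s => if has (fun g => profile (rebase g c) \in map profile s) gs
    then s else c :: s) [::] reps.

Definition stabiliser (c : seq pauli) : seq (seq (seq bool)) :=
  [seq g <- frames | profile (rebase g c) == profile c].

Definition firsts : seq (seq pauli) := Eval vm_compute in orbit_reps frames.

(** Once the first column is [r], only frames preserving its profile may be used to reduce the
    second. *)
Definition seconds : seq (seq pauli * seq (seq pauli)) := Eval vm_compute in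
  [seq (r, orbit_reps (stabiliser r)) | r <- firsts].

(** * Tries and the search for the remaining columns *)

Inductive btrie (A : Type) := BNode of btrie A & btrie A | BLeaf of seq A.

Fixpoint bbuild A d (l : seq (seq bool * A)) : btrie A :=
  if d is d'.+1 then
    BNode (bbuild d' [seq (behead x.1, x.2) | x <- l & head false x.1])
          (bbuild d' [seq (behead x.1, x.2) | x <- l & ~~ head false x.1])
  else BLeaf [seq x.2 | x <- l].

Fixpoint blookup A (t : btrie A) (k : seq bool) : seq A :=
  match t, k with
  | BNode l r, x :: k' => blookup (if x then l else r) k'
  | BLeaf s, _ => s
  | _, _ => [::]
  end.

Inductive ntrie := NEmpty | NNode of bool & seq ntrie.

Fixpoint nmem (t : ntrie) (k : seq nat) {struct k} : bool :=
  match t, k with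
  | NNode b _, [::] => b
  | NNode _ l, x :: k' => nmem (nth NEmpty l x) k'
  | NEmpty, _ => false
  end.

Fixpoint nadd (k : seq nat) (t : ntrie) {struct k} : ntrie :=
  let: (b, l) := if t is NNode b l then (b, l) else (false, [::]) in
  if k is x :: k' then NNode b (set_nth NEmpty l x (nadd k' (nth NEmpty l x)))
  else NNode true l.

(* An item (k, w, c) records a list c of columns, the sum k of their Gram
   vectors and the sum w of their weights. *)
Definition item : Type := seq bool * (seq nat * seq (seq pauli)).

Definition item_of (c : seq pauli) : item := (gram c, (weights c, [:: c])).

Definition item_add (x y : item) : item :=
  (bxor x.1 y.1, (addv x.2.1 y.2.1, x.2.2 ++ y.2.2)).

(** Unordered pairs, repetition allowed. *)
Fixpoint sums (s : seq item) : seq item :=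
  if s is x :: s' then map (item_add x) s ++ sums s' else [::].

Definition no_item : item := ([::], ([::], [::])).

(* All ways to complete the columns of x by those of an item of mid and by two
   further columns; t indexes the pairs of columns by their Gram vector. *)
Definition completions t (mid : seq item) (x : item) :
    seq (seq nat * seq (seq pauli)) :=
  flatten [seq let y := item_add x m in
    [seq (item_add y ([::], v)).2 | v <- blookup t (bxor y.1 gram0)] | m <- mid].

Definition prefixes : seq item :=
  flatten [seq [seq item_add (item_of rs.1) (item_of s) | s <- rs.2] | rs <- seconds].

(** Keeps one configuration for each new code. The result is only a candidate: [search] checks that
    no code is missing, and [codes_count] that every entry is valid. *)
Definition find_configs N (mid : seq item) : seq (seq (seq pauli)) :=
  let t := bbuild 10 (sums (map item_of reps)) in
  let f st v := let k := code N v.1 in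
    if nmem st.1 k then st else (nadd k st.1, v.2 :: st.2) in
  (foldl (fun st x => foldl f st (completions t mid x)) (NEmpty, [::]) prefixes).2.
(** Two columns come from the prefix and two from the final pair; four qubits leave nothing in the
    middle, five leave one column. *)
Definition configs4 := Eval vm_compute in find_configs 4 [:: no_item].
Definition configs5 := Eval vm_compute in find_configs 5 (map item_of reps).
Definition search N mid (s : seq (seq (seq pauli))) : bool :=
  let t := bbuild 10 (sums (map item_of reps)) in
  let codes := foldr nadd NEmpty (map (config_code N) s) in
  all (fun x => all (fun v => nmem codes (code N v.1)) (completions t mid x)) prefixes.
Lemma search4 : search 4 [:: no_item] configs4.
Proof. by vm_cast_no_check (erefl true). Qed.
Lemma search5 : search 5 (map item_of reps) configs5.
Proof. by vm_cast_no_check (erefl true). Qed.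
(** Checks directly that [firsts] meets every orbit, so that nothing about the greedy choice has to
    be proved. *)
Lemma first_column : let P := map profile firsts in
  all (fun c => has (fun g => profile (rebase g c) \in P) frames) reps.
Proof. by vm_cast_no_check (erefl true). Qed.
Lemma second_column : all (fun rs => 
  let gs := stabiliser rs.1 in let P := map profile rs.2 in
  all (fun c => has (fun g => profile (rebase g c) \in P) gs) reps) seconds.
Proof. by vm_cast_no_check (erefl true). Qed.
Lemma reps_cover : all (fun c => profile c \in map profile reps) (all_columns 5).
Proof. by vm_cast_no_check (erefl true). Qed.

(** * Completeness of the enumeration *)

Lemma mem_all_columns n c : size c = n -> c \in all_columns n.
Proof.
elim: c n => [|a c IHc] [|n] // [/IHc cn].
by apply: (allpairs_f (fun a c => a :: c)) cn; case: a.
Qed.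

Lemma all_columns_normalise c : all (fun col => size col == 5) c ->
  exists2 d, map profile d = map profile c & all (mem reps) d.
Proof.
elim: c => [|col c IHc] /=; first by exists [::].
case/andP=> /eqP /mem_all_columns/(allP reps_cover)/mapP[r rr ->] /IHc[d <- dr].
by exists (r :: d); rewrite //= [_ \in _]rr.
Qed.

Lemma size_reps c : all (mem reps) c -> all (fun col => size col == 5) c.
Proof.
apply: sub_all => col; exact: (allP (isT : all (fun col => size col == 5) reps)).
Qed.

(** Only the type is preserved: replacing a column by one of equal profile may change the doily. *)
Definition equivalent N (c d : seq (seq pauli)) : Prop :=
  [/\ size d = N, valid d & decode N (config_code N d) = decode N (config_code N c)].

Lemma equivalent_trans N b c d :
  equivalent N b c -> equivalent N c d -> equivalent N b d.
Proof. by move=> [_ _ e1] [? ? e2]; split; rewrite ?e2. Qed.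

Lemma equivalent_profile N c d : size c = N -> valid c ->
  map profile d = map profile c -> all (fun col => size col == 5) d ->
  equivalent N c d.
Proof.
move=> sc /andP[_ vc] pdc sd.
have gE : map gram d = map gram c.
  by have := congr1 (map fst) pdc; rewrite -!map_comp.
have wE : map weights d = map weights c.
  by have := congr1 (map snd) pdc; rewrite -!map_comp.
split; last by rewrite /config_code wE.
  by rewrite -sc -(size_map profile) pdc size_map.
by rewrite /valid sd gE.
Qed.

Lemma pairing_map (T U S : Type) (f : T -> U) (r : U -> U -> S) s :
  pairing r (map f s) = pairing (fun x y => r (f x) (f y)) s.
Proof. by elim: s => //= x s ->; rewrite -map_comp. Qed.

Lemma eq_in_pairing (T : eqType) (S : Type) (r r' : T -> T -> S) s :
  {in s &, r =2 r'} -> pairing r s = pairing r' s.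
Proof.
elim: s => //= x s IHs h; congr (_ ++ _).
  by apply/eq_in_map => y ys; apply: h; rewrite inE ?eqxx ?ys ?orbT.
by apply: IHs => y z ys zs; apply: h; rewrite inE ?ys ?zs orbT.
Qed.

(* A rebased configuration describes the same doily in another frame. *)
Lemma equivalent_rebase N c g : size c = N -> valid c -> frame g ->
  equivalent N c (map (rebase g) c).
Proof.
move=> /eqP sc vc; pose t := Tuple sc; rewrite -[c]/(tval t) in vc *.
case/and3P=> /eqP sg /allP gp /eqP gg.
have tE : tval (columns (map (word t) g)) = map (rebase g) t.
  apply: (@eq_from_nth _ [::]) => [|i]; first by rewrite size_map !size_tuple.
  rewrite size_tuple => iN; rewrite -[i]/(nat_of_ord (Ordinal iN)) -tnth_nth.
  rewrite tnth_mktuple (nth_map [::]) ?size_tuple // -tnth_nth -map_comp.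
  by apply: eq_map => u /=; rewrite tnth_map.
have vd : valid (columns (map (word t) g)).
  apply: valid_columns; first by rewrite size_map.
  rewrite pairing_map -gg; apply: eq_in_pairing => u v /gp pu /gp pv.
  by rewrite (wanti_word vc) ?size_points.
have /existsP[L DL] := span_points_doily vc.
have DE : span_points t = span_points (columns (map (word t) g)).
  apply: (doily_span DL vd) => u /(nthP [::])[k k5 <-].
  rewrite (word_columns (word t [::])) ?size_map // (nth_map [::]) ?sg //.
  have [f fE] := point_obs_exists vc.
  have pk : nth [::] g k \in points by apply/gp/mem_nth; rewrite sg.
  exists (f (nth [::] g k)); last by rewrite fE.
  by rewrite (span_pointsE fE) in_set map_f.
rewrite -tE; split; rewrite ?size_tuple // -!doily_type_span //.
by rewrite DE.
Qed.

(** Two rebasings bring the first and then the second column into the reduced lists; after each, the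
    columns are replaced by representatives of equal profile. *)
Lemma equivalent_search_form N c : size c = N.+2 -> valid c ->
  exists r s d, [/\ item_add (item_of r) (item_of s) \in prefixes,
    all (mem reps) d, size d = N & equivalent N.+2 c [:: r, s & d]].
Proof.
have fr g : g \in frames -> frame g.
  by move: g; apply/allP; vm_cast_no_check (erefl true).
move=> sc vc.
have [c1 pc1 rc1] : exists2 d, map profile d = map profile c & all (mem reps) d.
  by apply: all_columns_normalise; case/andP: vc.
have q1 := equivalent_profile sc vc pc1 (size_reps rc1).
case: c1 rc1 q1 {pc1} => [|a c1] rc1 q1; first by case: q1.
have [s1 v1 _] := q1.
have /hasP[g gf /mapP[r rF pr]] := allP first_column a (proj1 (andP rc1)).
have q2 := equivalent_rebase s1 v1 (fr g gf).
have [s2 v2 _] := q2.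
have [c2 pc2 rc2] : exists2 d,
    map profile d = map profile (map (rebase g) c1) & all (mem reps) d.
  by apply: all_columns_normalise; case/andP: v2 => /andP[].
have [P rP] : exists P, (r, P) \in seconds.
  have : r \in map fst seconds by exact: rF.
  by case/mapP=> [[r' P] rP ->]; exists P.
have := allP (isT : all (fun rs : _ * _ => all (fun c => size c == 5) (rs.1 :: rs.2))
  seconds) _ rP.
case/andP=> sr /allP sP5.
have q3 : equivalent N.+2 (map (rebase g) (a :: c1)) (r :: c2).
  apply: equivalent_profile => //; first by rewrite /= pr pc2.
  by rewrite /= sr size_reps.
have [s3 v3 _] := q3.
case: c2 rc2 pc2 q3 s3 v3 => [|b c2] rc2 pc2 q3 s3 v3 //.
(* The frame [h] stabilises the profile of [r], so the second rebasing does not undo the first. *)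
have /hasP[h hS /mapP[s sP ps]] := allP (allP second_column _ rP) b (proj1 (andP rc2)).
move: hS; rewrite mem_filter => /andP[/eqP ph hf].
have q4 := equivalent_rebase s3 v3 (fr h hf).
have [s4 v4 _] := q4.
have [d pd rd] : exists2 d,
    map profile d = map profile (map (rebase h) c2) & all (mem reps) d.
  by apply: all_columns_normalise; case/andP: v4 => /and3P[].
have q5 : equivalent N.+2 (map (rebase h) [:: r, b & c2]) [:: r, s & d].
  apply: equivalent_profile => //; first by rewrite /= ph ps pd.
  by rewrite /= sr sP5 ?size_reps.
exists r, s, d; split => //.
- apply/flattenP; eexists; first by apply/mapP; exists (r, P); [exact: rP|].
  exact: (map_f (fun t => item_add (item_of r) (item_of t))).
- by have [[]] := q5.
apply: equivalent_trans q1 (equivalent_trans q2 (equivalent_trans q3 _)).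
exact: equivalent_trans q4 q5.
Qed.

Lemma mem_blookup (A : eqType) d (l : seq (seq bool * A)) k v :
  (k, v) \in l -> size k = d -> v \in blookup (bbuild d l) k.
Proof.
elim: d l k => [|d IHd] l [|x k] // kl; first by move=> _; apply: (map_f snd kl).
case=> sk /=; case: x kl => kl; apply: IHd sk; apply/mapP;
  [exists (true :: k, v) | exists (false :: k, v)] => //; by rewrite mem_filter kl.
Qed.

Lemma nmem_nadd k t k' : nmem (nadd k t) k' = (k' == k) || nmem t k'.
Proof.
have nmem0 s : nmem NEmpty s = false by case: s.
elim: k t k' => [|x k IHk] [|b l] [|y k'] //=; rewrite ?nth_nil ?nmem0 //.
  rewrite nth_set_nth /= eqseq_cons; case: eqP => [_|_] /=.
    by rewrite IHk nmem0.
  by rewrite nth_nil nmem0.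
by rewrite nth_set_nth /= eqseq_cons; case: eqP => [->|_] //=; rewrite IHk.
Qed.

Lemma nmem_foldr_nadd s k : nmem (foldr nadd NEmpty s) k = (k \in s).
Proof. by elim: s => [|x s IHs] /=; [case: k | rewrite nmem_nadd IHs inE]. Qed.

Lemma addvC u v : addv u v = addv v u.
Proof. by elim: u v => [|x u IHu] [|y v] //=; rewrite addnC IHu. Qed.

Lemma addvA u v w : addv u (addv v w) = addv (addv u v) w.
Proof. by elim: u v w => [|x u IHu] [|y v] [|z w] //=; rewrite addnA IHu. Qed.

(** Each pair is listed in one order only. Gram vectors and weights are symmetric, but the recorded
    columns are not, hence the existential [cs]. *)
Lemma mem_sums l x y : x \in l -> y \in l ->
  exists cs, (bxor x.1 y.1, (addv x.2.1 y.2.1, cs)) \in sums l.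
Proof.
elim: l => // z l IHl.
have zP t : t \in z :: l -> item_add z t \in sums (z :: l).
  by move=> tl; rewrite [sums _]/= -cat_cons mem_cat (map_f (item_add z) tl).
case/predU1P=> [->|xl]; first by move=> yl; exists (z.2.2 ++ y.2.2); apply: zP.
case/predU1P=> [->|yl].
  exists (z.2.2 ++ x.2.2); rewrite bxorC addvC; apply: zP.
  by apply/predU1P; right.
have [cs h] := IHl xl yl; exists cs.
by rewrite [sums _]/= -cat_cons mem_cat h orbT.
Qed.

Lemma size_gram col : size col == 5 -> size (gram col) = 10.
Proof. by case: col => [|a [|b [|c [|d [|e []]]]]]. Qed.

(** The Gram vectors must sum to [gram0], so that of the last pair is forced by the other columns
    and is the key under which the pair is looked up. *)
Lemma searchP N mid confs x m c1 c2 : search N mid confs ->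
  x \in prefixes -> m \in mid -> c1 \in reps -> c2 \in reps ->
  size (bxor x.1 m.1) = 10 ->
  bxor (bxor x.1 m.1) (bxor (gram c1) (gram c2)) = gram0 ->
  code N (addv (addv x.2.1 m.2.1) (addv (weights c1) (weights c2)))
    \in map (config_code N) confs.
Proof.
move=> + xp mm r1 r2 sxm e; rewrite /search => /allP/(_ x xp)/allP h.
have s1 : size (gram c1) = 10.
  by apply/size_gram/(allP (isT : all (fun col => size col == 5) reps)).
have s2 : size (gram c2) = 10.
  by apply/size_gram/(allP (isT : all (fun col => size col == 5) reps)).
have [cs hcs] := mem_sums (map_f item_of r1) (map_f item_of r2).
rewrite -nmem_foldr_nadd.
apply: (h (addv (addv x.2.1 m.2.1) (addv (weights c1) (weights c2)),
  (x.2.2 ++ m.2.2) ++ cs)).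
apply/flattenP; eexists; first by apply/mapP; exists m.
apply/mapP; exists (addv (weights c1) (weights c2), cs) => //.
apply: mem_blookup; last by rewrite size_bxor sxm.
by rewrite -e bxorK // size_bxor s1 s2.
Qed.

Lemma search4_complete confs c :
  search 4 [:: no_item] confs -> size c = 4 -> valid c ->
  decode 4 (config_code 4 c) \in map (decode 4) (map (config_code 4) confs).
Proof.
move=> search_ok sc /(equivalent_search_form sc)[r [s [d [xp rd sd [_ vd <-]]]]].
apply: map_f; case: d rd sd vd => [|c1 [|c2 []]] //= /and3P[r1 r2 _] _.
case/andP=> /andP[sr /andP[ss _]] /eqP gE.
have := searchP search_ok xp (mem_head no_item [::]) r1 r2.
rewrite /config_code; cbn [map foldr item_add item_of no_item fst snd] in gE |- *.
rewrite -!addvA !addv_nil; apply.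
  by rewrite !size_bxor !size_gram.
by rewrite -!bxorA -gE; case: (gram c2).
Qed.

Lemma search5_complete confs c :
  search 5 (map item_of reps) confs -> size c = 5 -> valid c ->
  decode 5 (config_code 5 c) \in map (decode 5) (map (config_code 5) confs).
Proof.
move=> search_ok sc /(equivalent_search_form sc)[r [s [d [xp rd sd [_ vd <-]]]]].
apply: map_f; case: d rd sd vd => [|c0 [|c1 [|c2 []]]] //= /and4P[r0 r1 r2 _] _.
case/andP=> /and3P[sr ss /andP[s0 _]] /eqP gE.
have := searchP search_ok xp (map_f item_of r0) r1 r2.
rewrite /config_code; cbn [map foldr item_add item_of fst snd] in gE |- *.
rewrite -!addvA !addv_nil; apply.
  by rewrite !size_bxor !size_gram.
by rewrite -!bxorA -gE; case: (gram c2).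
Qed.

(** * Counting the types *)

Definition codes_count N (confs : seq (seq (seq pauli))) (l q : nat) : bool :=
  let codes := map (config_code N) confs in
  [&& all (fun c => (size c == N) && valid c) confs, uniq codes,
      all (fun s => (size s == N.+1) && (head 0 s <= 1)) codes,
      count (fun s => head 0 s == 1) codes == l
    & count (fun s => head 0 s != 1) codes == q].

Lemma doily_types_count N (confs : seq (seq (seq pauli))) l q :
  (forall c, size c = N -> valid c ->
     decode N (config_code N c) \in map (decode N) (map (config_code N) confs)) ->
  codes_count N confs l q ->
  [/\ size (doily_types N) = l + q,
      count (fun t => t.2 == Some Linear) (doily_types N) = l
    & count (fun t => t.2 == Some Quadratic) (doily_types N) = q].
Proof.
move=> complete /and5P[/allP sound].
set codes := map (config_code N) confs in complete *.
move=> uc /allP shape /eqP <- /eqP <-.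
(* The length N + 1 and a flag at most 1 leave nothing in a code that its decoding loses. *)
have decode_inj : {in codes &, injective (decode N)}.
  move=> s t /shape/andP[/eqP ss hs] /shape/andP[/eqP st ht] e.
  apply: (@eq_from_nth _ 0) => [|[|k]]; rewrite ?ss ?st // => kN.
    have := congr1 snd e; rewrite /= !nth0; move: (head 0 s) (head 0 t) hs ht.
    by move=> [|[|?]] [|[|?]].
  have := congr1 (fun t : N.-tuple nat * _ => tnth t.1 (Ordinal (kN : k < N))) e.
  by rewrite !tnth_mktuple.
(* Completeness of the search gives one inclusion; the doily spanned by each listed configuration
   gives the other. *)
have perm : perm_eq (doily_types N) (map (decode N) codes).
  apply: uniq_perm; rewrite ?undup_uniq ?(map_inj_in_uniq decode_inj) // => t.
  rewrite mem_undup; apply/imageP/idP => [[D dD ->]|].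
    have [c vc ->] := doily_config dD.
    by rewrite doily_type_span // complete ?size_tuple.
  case/mapP=> _ /mapP[c /sound/andP[sc vc] ->] ->.
  exists (span_points (Tuple sc)); first exact: span_points_doily.
  by rewrite doily_type_span.
split; rewrite ?(perm_size perm) ?(permP perm).
- by rewrite size_map -(count_predC (fun s => head 0 s == 1)).
- by rewrite count_map; apply: eq_count => s /=; case: (_ == 1).
by rewrite count_map; apply: eq_count => s /=; case: (_ == 1).
Qed.

Lemma codes_count4 : codes_count 4 configs4 24 71.
Proof. by vm_compute. Qed.

Lemma codes_count5 : codes_count 5 configs5 89 358.
Proof. by vm_compute. Qed.

Theorem mainTheorem7 :
  [/\ size (doily_types 4) = 95,
      count (fun t => t.2 == Some Linear) (doily_types 4) = 24
    & count (fun t => t.2 == Some Quadratic) (doily_types 4) = 71]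
  /\
  [/\ size (doily_types 5) = 447,
      count (fun t => t.2 == Some Linear) (doily_types 5) = 89
    & count (fun t => t.2 == Some Quadratic) (doily_types 5) = 358].
Proof.
split.
  by apply: doily_types_count codes_count4 => c; apply: search4_complete search4.
by apply: doily_types_count codes_count5 => c; apply: search5_complete search5.
Qed.
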